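(* Let $r\geq 2$ and $t \geq 3$ be integers. If $n = a(r+t-3) + b$ with nonnegative integers $a,b$ and $b \leq r+t-4$, then \[a\binom{r+t-3}{r} + \binom{b}{r} \leq {\rm ex}_{r}(n, {\rm B}_{\rm ind} K_{1,t-1}) \leq \frac{n}{r}\binom{r + t - 3}{r-1} .\] In particular, if $n$ is divisible by $r+t-3$, the lower bound equals $\frac{n}{r}\binom{r+t-4}{r-1}$.
   Context: $K_{1,t-1}$ is the star with one center and $t-1$ leaves. An $r$-uniform hypergraph $\mathcal H$ is a family of $r$-element subsets (edges) of a finite vertex set $V(\mathcal H)$. For a graph $F$ with vertex set $\{v_1,\dots,v_p\}$ and edge set $\{e_1,\dots,e_q\}$, $\mathcal H$ contains an induced Berge $F$ if there exist distinct vertices $W=\{w_1,\dots,w_p\}\subseteq V(\mathcal H)$ and distinct edges $f_1,\dots,f_q$ of $\mathcal H$ such that whenever $e_i=v_\alpha v_\beta$ we have $f_i\cap W=\{w_\alpha,w_\beta\}$. ${\rm ex}_r(n,{\rm B}_{\rm ind}F)$ is the maximum number of edges of an $r$-uniform hypergraph on vertex set $[n]$ with no induced Berge $F$. Binomial coefficients $\binom{b}{r}$ with $b<r$ equal $0$. *)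

(* Defs.v *)
From mathcomp Require Import all_boot all_order all_algebra.

Set Implicit Arguments.
Unset Strict Implicit.
Unset Printing Implicit Defensive.

Record sgraph := SGraph {
  vertex :> finType;
  adj : rel vertex;
  adj_sym : symmetric adj;
  adj_irr : irreflexive adj }.

Definition edges (F : sgraph) : {set {set F}} :=
  [set [set p.1; p.2] | p : F * F & adj p.1 p.2].

Section Star.
Variable s : nat.

(* The star K_{1,s}: the centre is ord0, the s other vertices are the leaves. *)
Definition star_adj : rel 'I_s.+1 := [rel i j | (i == ord0) != (j == ord0)].

Fact star_adj_sym : symmetric star_adj.
Proof. by move=> i j; rewrite /star_adj /= eq_sym. Qed.

Fact star_adj_irr : irreflexive star_adj.
Proof. by move=> i; rewrite /star_adj /= eqxx. Qed.

Definition star : sgraph := SGraph star_adj_sym star_adj_irr.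

End Star.

Definition uniform (r : nat) (T : finType) (H : {set {set T}}) : bool :=
  [forall e in H, #|e| == r].

(* w gives the distinct vertices (W is its image) and f the distinct edges of H
   indexed by the edges of F; the values of f outside [edges F] are irrelevant. *)
Definition induced_Berge (F : sgraph) (T : finType) (H : {set {set T}}) : bool :=
  [exists w : {ffun F -> T}, exists f : {ffun {set F} -> {set T}},
    [&& injectiveb w,
        dinjectiveb f [in edges F]
      & [forall e in edges F,
          (f e \in H) && (f e :&: (w @: [set: F]) == w @: e)]]].

(* The maximum is over a nonempty family as soon as F has an edge, since then
   H = set0 is admissible; over an empty family it is 0. *)
Definition ex_ind_Berge (r n : nat) (F : sgraph) : nat :=
  \max_(H : {set {set 'I_n}} | uniform r H && ~~ induced_Berge F H) #|H|.

(* Main.v *)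
(* Upper bound: fix a vertex v and, for every edge e through v, take a minimal
   set B e disjoint from e that meets every other edge through v.  By
   minimality each b in B e has a private edge, meeting B e in b only, so v and
   B e form an induced Berge star with #|B e| leaves, whence #|B e| <= t - 2.
   The pairs (e :\ v, B e) satisfy the hypotheses of Bollobas's set-pairs
   inequality, which bounds the degree of v by 'C(r + t - 3, r - 1); sum over v.
   Lower bound: in a disjoint union of complete r-graphs on at most r + t - 3
   vertices, one edge of an induced star together with the remaining t - 2
   leaves would be r + t - 2 vertices of a single component. *)

Require Import Defs.
From mathcomp Require Import all_boot all_order all_algebra.
From mathcomp Require Import zify.

Import Order.TTheory GRing.Theory Num.Theory.
Local Open Scope ring_scope.

(** * Induced Berge stars in terms of centre and leaves *)

Lemma mem_edges_star (s : nat) (e : {set star s}) :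
  reflect (exists i : 'I_s, e = [set ord0; lift ord0 i]) (e \in edges (star s)).
Proof.
apply: (iffP imsetP) => [[[x y] /= xy ->]|[i ->]]; last first.
  by exists (ord0 : star s, lift ord0 i : star s); rewrite // inE.
move: xy; rewrite inE /= /star_adj /=.
case: (unliftP ord0 x) => [i ->|->]; case: (unliftP ord0 y) => [j ->|->] //= _.
  by exists i; rewrite setUC.
by exists j.
Qed.

(** Each edge of a star is determined by its leaf, so the edges of [H] can be indexed by leaves. The
    last clause makes both [w] and [f] injective. *)
Lemma star_inducedP (s : nat) (T : finType) (H : {set {set T}}) :
  reflect (exists (c : T) (w : 'I_s -> T) (f : 'I_s -> {set T}),
             forall i, [/\ f i \in H, c \in f i, c != w i
                         & forall j, (w j \in f i) = (j == i)])
          (induced_Berge (star s) H).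
Proof.
apply: (iffP existsP) => [[w /existsP[f /and3P[/injectiveP winj _ /forall_inP fP]]]|].
  exists (w ord0), (fun i => w (lift ord0 i)), (fun i => f [set ord0; lift ord0 i]) => i.
  have /fP/andP[fH /eqP fW]: [set ord0; lift ord0 i] \in edges (star s).
    by apply/mem_edges_star; exists i.
  have memf x : (w x \in f [set ord0; lift ord0 i]) = (x \in [set ord0; lift ord0 i]).
    by rewrite -[RHS](mem_imset _ _ winj) -fW in_setI imset_f ?andbT.
  split=> //; first by rewrite memf set21.
    by rewrite (inj_eq winj).
  by move=> j; rewrite memf !inE (inj_eq lift_inj).
case=> c [w [f P]].
have winj : injective w.
  by move=> i j wij; have [_ _ _ fj] := P j; apply/eqP; rewrite -fj wij fj.
pose w' : {ffun star s -> T} :=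
  [ffun x : 'I_s.+1 => if unlift ord0 x is Some i then w i else c].
(* The leaf is read off from the edge; sets without a leaf are not edges and get the dummy value
   [set0]. *)
pose f' : {ffun {set star s} -> {set T}} :=
  [ffun e : {set 'I_s.+1} =>
     if [pick i | lift ord0 i \in e] is Some i then f i else set0].
have w0 : w' ord0 = c by rewrite ffunE unlift_none.
have wl i : w' (lift ord0 i) = w i by rewrite ffunE liftK.
have fl i : f' [set ord0; lift ord0 i] = f i.
  rewrite ffunE; case: pickP => [j|/(_ i)]; last by rewrite set22.
  by rewrite !inE /= (inj_eq lift_inj) => /eqP->.
have w'inj : injective w'.
  move=> x y; case: (unliftP ord0 x) => [i ->|->]; case: (unliftP ord0 y) => [j ->|->] //.
  - by rewrite !wl => /winj ->.
  - by rewrite wl w0 => e; have [_ _] := P i; rewrite e eqxx.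
  - by rewrite wl w0 => e; have [_ _] := P j; rewrite e eqxx.
exists w'; apply/existsP; exists f'; apply/and3P; split.
- exact/injectiveP.
- apply/dinjectiveP => _ _ /mem_edges_star[i ->] /mem_edges_star[j ->].
  rewrite !fl => fij; suff -> : i = j by [].
  have [_ _ _ fi] := P i; have [_ _ _ fj] := P j.
  by apply/eqP; rewrite -fj -fij fi.
- apply/forall_inP => _ /mem_edges_star[i ->]; rewrite fl.
  have [-> cf _ fi] := P i; apply/eqP/setP => x; rewrite in_setI.
  apply/andP/imsetP => [[xf /imsetP[y _ xE]]|[y yi ->]].
    exists y => //; move: xf; rewrite xE.
    case: (unliftP ord0 y) => [j ->|->]; last by rewrite set21.
    by rewrite wl fi => /eqP->; rewrite set22.
  split; last exact: imset_f.
  by move: yi; rewrite !inE => /orP[]/eqP->; rewrite ?w0 // wl fi.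
Qed.

(** * Bollobas's set-pairs inequality *)

(** Absorption turns the second summand into [(a + b) / 'C(a + b, a)]. In the use below [N] is the
    size of the ground set: the [N - (a + b)] points outside a pair leave it unchanged, and each of
    the [b] points of its second set shrinks that set by one. *)
Lemma bollobas_term (a b N : nat) : (0 < b)%N -> (a + b <= N)%N ->
  (N - (a + b))%:R / ('C(a + b, a))%:R + b%:R / ('C(a + b.-1, a))%:R
    = N%:R / ('C(a + b, a))%:R :> rat.
Proof.
case: b => // b _ abN /=.
have /(congr1 (fun k => k%:R : rat)) : (b.+1 * 'C(a + b.+1, a) = (a + b.+1) * 'C(a + b, a))%N.
  by have := mul_bin_down (a + b.+1) a; rewrite addKn addnS.
rewrite !natrM => e.
have p1 : ('C(a + b.+1, a))%:R != 0 :> rat by rewrite pnatr_eq0 -lt0n bin_gt0 leq_addr.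
have p2 : ('C(a + b, a))%:R != 0 :> rat by rewrite pnatr_eq0 -lt0n bin_gt0 leq_addr.
have -> : b.+1%:R / ('C(a + b, a))%:R = (a + b.+1)%:R / ('C(a + b.+1, a))%:R :> rat.
  by apply/eqP; rewrite eqr_div // e.
by rewrite -mulrDl -natrD subnK.
Qed.

(* Induction on the ground set X: for each x in X, restrict to the pairs with
   x \notin A i and delete x from B i, then sum over x; by [bollobas_term] the
   pair i contributes exactly #|X| times its weight. *)
Lemma bollobas_set_pairs (I T : finType) (S : {set I}) (A B : I -> {set T}) :
  {in S, forall i, [disjoint A i & B i]} ->
  {in S &, forall i j, i != j -> ~~ [disjoint A i & B j]} ->
  \sum_(i in S) (('C(#|A i| + #|B i|, #|A i|))%:R)^-1 <= 1 :> rat.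
Proof.
suff main (X : {set T}) : {in S, forall i, A i :|: B i \subset X} ->
    {in S, forall i, [disjoint A i & B i]} ->
    {in S &, forall i j, i != j -> ~~ [disjoint A i & B j]} ->
  \sum_(i in S) (('C(#|A i| + #|B i|, #|A i|))%:R)^-1 <= 1 :> rat.
  by apply: (main setT) => i _; apply: subsetT.
have [N] := ubnP #|X|; elim: N => // N IH in X S A B *.
rewrite ltnS => XN sub dis cross.
have [S1|S2] := leqP #|S| 1.
  have [i Si|S0] := pickP (mem S); last by rewrite big_pred0.
  have -> : S = [set i].
    by apply/eqP; rewrite eq_sym eqEcard sub1set cards1 S1 andbT.
  by rewrite big_set1 invf_le1 ?ltr0n ?ler1n bin_gt0 leq_addr.
have other i : i \in S -> exists2 j, j \in S & j != i.
  move=> Si; have /card_gt0P[j] : (0 < #|S :\ i|)%N.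
    by move: S2; rewrite (cardsD1 i) Si.
  by rewrite !inE => /andP[ji Sj]; exists j.
(* With at least two pairs, some other [A j] meets [B i]. *)
have Bgt0 i : i \in S -> (0 < #|B i|)%N.
  move=> Si; have [j Sj ji] := other i Si.
  by rewrite card_gt0; apply: contraNneq (cross j i Sj Si ji) => ->; rewrite -setI_eq0 setI0.
have Xgt0 : (0 < #|X|)%N.
  have /card_gt0P[i Si] : (0 < #|S|)%N by apply: ltnW.
  apply: leq_trans (Bgt0 i Si) (subset_leq_card _).
  by apply: subset_trans (sub i Si); apply: subsetUr.
pose F x := \sum_(i in S | x \notin A i)
   (('C(#|A i| + #|B i :\ x|, #|A i|))%:R)^-1 : rat.
have F1 x : x \in X -> F x <= 1.
  move=> Xx; rewrite /F.
  have := IH (X :\ x) [set i in S | x \notin A i] A (fun i => B i :\ x).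
  rewrite (eq_bigl (fun i => (i \in S) && (x \notin A i))) => [|i]; last by rewrite inE.
  apply.
  - by move: XN; rewrite (cardsD1 x) Xx.
  - move=> i; rewrite inE => /andP[Si xA].
    apply/subsetP => y yAB; have /subsetP/(_ y) := sub i Si.
    move: yAB; rewrite !inE.
    case: (eqVneq y x) => [->|_] /=; first by rewrite (negPf xA).
    by move=> ? ->.
  - move=> i; rewrite inE => /andP[Si xA].
    exact: disjointWr (subsetDl _ _) (dis i Si).
  - move=> i j; rewrite !inE => /andP[Si xA] /andP[Sj xA'] ij.
    (* Since [x] is not in [A i], deleting it from [B j] keeps the intersection with [A i]. *)
    apply: contra (cross i j Si Sj ij) => /pred0P d; apply/pred0P => y /=.
    have := d y; rewrite /= !inE; case: (eqVneq y x) => [->|_] //=.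
    by rewrite (negPf xA).
have: \sum_(x in X) F x <= \sum_(x in X) 1 by apply: ler_sum.
rewrite sumr_const.
suff -> : \sum_(x in X) F x =
   #|X|%:R * \sum_(i in S) (('C(#|A i| + #|B i|, #|A i|))%:R)^-1.
  by rewrite -[X in _ <= X]mulr1 ler_pM2l // ltr0n.
rewrite /F (exchange_big_dep (mem S)) /=; last by move=> x i _ /andP[].
rewrite mulr_sumr; apply: eq_bigr => i Si.
have ABd : [disjoint A i & B i] := dis i Si.
have cAB : #|A i :|: B i| = (#|A i| + #|B i|)%N.
  by apply/eqP; rewrite (leq_card_setU _ _).2.
have leX : (#|A i| + #|B i| <= #|X|)%N by rewrite -cAB subset_leq_card ?sub.
(* The points outside [A i] are split by membership in [B i], matching the two summands. *)
rewrite -(bollobas_term _ _ _ (Bgt0 i Si) leX) (bigID (mem (B i))) /= addrC.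
congr (_ + _).
  rewrite (eq_big (mem (X :\: (A i :|: B i)))
    (fun=> (('C(#|A i| + #|B i|, #|A i|))%:R)^-1)) /=; first last.
  - move=> x /andP[_ xB]; congr ((('C(_ + _, _))%:R)^-1).
    by rewrite [in RHS](cardsD1 x) (negPf xB).
  - by move=> x; rewrite !inE Si; case: (x \in X); case: (x \in A i); case: (x \in B i).
  rewrite sumr_const cardsD -cAB (setIidPr _) ?sub //.
  by rewrite -[LHS]mulr_natl.
rewrite (eq_big (mem (B i)) (fun=> (('C(#|A i| + #|B i|.-1, #|A i|))%:R)^-1)) /=; first last.
- move=> x /andP[_ xB]; congr ((('C(_ + _, _))%:R)^-1).
  by rewrite [in RHS](cardsD1 x) xB.
- move=> x; rewrite Si /=; have [xB|] := boolP (x \in B i); rewrite ?andbF ?andbT //.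
  rewrite (subsetP (sub i Si)) ?inE ?xB ?orbT //=.
  by apply: contraL xB => xA; rewrite (disjointFr ABd xA).
by rewrite sumr_const -[LHS]mulr_natl.
Qed.

(** * Upper bound: vertex degrees in a star-free hypergraph *)

Lemma star_free_degree (r s : nat) (T : finType) (H : {set {set T}}) (v : T) :
  uniform r H -> ~~ induced_Berge (star s.+1) H ->
  (#|[set e in H | v \in e]| <= 'C(r.-1 + s, r.-1))%N.
Proof.
move=> /forall_inP unif free; set S := [set e in H | v \in e].
have SH e : e \in S -> e \in H by rewrite inE => /andP[].
have Sv e : e \in S -> v \in e by rewrite inE => /andP[].
have cardS e : e \in S -> #|e| = r by move=> /SH/unif/eqP.
pose p (e C : {set T}) := [disjoint e & C] &&
  [forall G in S, (G != e) ==> ~~ [disjoint G & C]].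
pose B e := odflt set0 [pick C | minset (p e) C].
have BP e : e \in S -> minset (p e) (B e).
  move=> Se; rewrite /B; case: pickP => //= none.
  (* The complement of [e] qualifies: another edge of the same size cannot lie inside [e]. *)
  have pe : p e (~: e).
    rewrite /p disjoints_subset setCK subxx /=; apply/forall_inP => G SG.
    apply/implyP; apply: contra; rewrite disjoints_subset setCK => Ge.
    by rewrite eqEcard Ge (cardS e Se) (cardS G SG) leqnn.
  by have [C mC _] := minset_exists pe; rewrite none in mC.
have Bdis e : e \in S -> [disjoint e & B e].
  by move=> /BP/minsetP[/andP[]].
have Bmeet e G : e \in S -> G \in S -> G != e -> ~~ [disjoint G & B e].
  by move=> /BP/minsetP[/andP[_ /forall_inP h] _] SG; apply/implyP/h.
have Bcard e : e \in S -> (#|B e| <= s)%N.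
  move=> Se; rewrite leqNgt; apply: contra free => sB.
  apply/star_inducedP; exists v.
  pose w (i : 'I_s.+1) := enum_val (widen_ord sB i).
  have wB i : w i \in B e by apply: enum_valP.
  have winj : injective w.
    by move=> i j /enum_val_inj/(congr1 val) /= /val_inj.
  (* By minimality some edge [G] other than [e] misses [B e :\ w i]; as it meets [B e], it does so
     in [w i] only. *)
  have priv i : exists G, G \in S /\ forall x, x \in B e -> (x \in G) = (x == w i).
    have /minsetP[_ minB] := BP e Se.
    have /negP : ~ p e (B e :\ w i).
      by move=> /minB/(_ (subsetDl _ _)) E; have := wB i; rewrite -E !inE eqxx.
    rewrite /p (disjointWr (subsetDl _ _) (Bdis e Se)) /= => /forall_inPn[G SG].
    rewrite negb_imply negbK => /andP[Ge dG]; exists G; split=> // x xB.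
    have off y : y \in B e -> y \in G -> y == w i.
      move=> yB yG; apply: contraTT yG => yw.
      by rewrite (disjointFl dG) // !inE yw.
    apply/idP/eqP => [xG|->]; first exact/eqP/off.
    have /pred0Pn[y /= /andP[yG yB]] := Bmeet e G Se SG Ge.
    by rewrite -(eqP (off y yB yG)).
  have [f fP] := fin_all_exists priv.
  exists w, f => i; have [Sf fB] := fP i.
  split; [exact: SH|exact: Sv| |by move=> j; rewrite fB // (inj_eq winj)].
  by apply: contraTneq (wB i) => <-; rewrite (disjointFr (Bdis e Se)) ?Sv.
have Cgt0 : 0 < ('C(r.-1 + s, r.-1))%:R :> rat by rewrite ltr0n bin_gt0 leq_addr.
have cardA e : e \in S -> #|e :\ v| = r.-1.
  by move=> Se; rewrite -(cardS e Se) [in RHS](cardsD1 v) Sv.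
have := bollobas_set_pairs _ _ S (fun e => e :\ v) B.
have dis : {in S, forall e, [disjoint e :\ v & B e]}.
  by move=> e Se; apply: disjointWl (subsetDl _ _) (Bdis e Se).
have cross : {in S &, forall e G, e != G -> ~~ [disjoint e :\ v & B G]}.
  (* The common point differs from [v], because [v] lies in [G] and [B G] avoids [G]. *)
  move=> e G Se SG eG; have /pred0Pn[x /= /andP[xe xB]] := Bmeet G e SG Se eG.
  apply/pred0Pn; exists x; rewrite /= !inE xe xB !andbT.
  by apply: contraTneq xB => ->; rewrite (disjointFr (Bdis G SG)) ?Sv.
move=> /(_ dis cross) le1.
(* Every term of the set-pairs sum is at least the reciprocal of ['C(r.-1 + s, r.-1)]. *)
rewrite -(ler_nat rat) -[leRHS]mul1r -ler_pdivrMr //; apply: le_trans le1.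
rewrite mulrC mulr_natr -sumr_const; apply: ler_sum => e Se.
rewrite cardA // lef_pV2 ?posrE ?ltr0n ?bin_gt0 ?leq_addr // ler_nat.
by rewrite leq_bin2l // leq_add2l Bcard.
Qed.

(** Double counting of the incidences between vertices and edges. *)
Lemma star_free_card (r s : nat) (T : finType) (H : {set {set T}}) :
  uniform r H -> ~~ induced_Berge (star s.+1) H ->
  (#|H| * r <= #|T| * 'C(r.-1 + s, r.-1))%N.
Proof.
move=> unif free.
have -> : (#|H| * r = \sum_(v : T) #|[set e in H | v \in e]|)%N.
  rewrite -sum_nat_const.
  rewrite (eq_bigr (fun v => \sum_(e in H | v \in e) 1)%N); last first.
    by move=> v _; rewrite -sum1_card; apply: eq_bigl => e; rewrite inE.
  rewrite (exchange_big_dep (mem H)) /=; last by move=> v e _ /andP[].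
  apply: eq_bigr => e He; have /eqP <- := forall_inP unif e He.
  by rewrite -sum1_card; apply: eq_bigl => v; rewrite He.
by rewrite -sum_nat_const; apply: leq_sum => v _; apply: star_free_degree.
Qed.

(** * Lower bound: disjoint complete hypergraphs *)

Definition clique_block (m n k : nat) : {set 'I_n} := [set i : 'I_n | i %/ m == k]%N.

Lemma card_clique_block_le (m n k : nat) : (0 < m)%N -> (#|clique_block m n k| <= m)%N.
Proof.
move=> m0; rewrite -[leqRHS]card_ord.
rewrite -(@card_in_imset _ _ (fun i : 'I_n => Ordinal (ltn_pmod i m0))) ?max_card //.
move=> i j; rewrite !inE => /eqP ik /eqP jk [] ij; apply/val_inj.
by rewrite /= (divn_eq i m) (divn_eq j m) ik jk ij.
Qed.

Lemma card_clique_block_ge (m n k c : nat) :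
  (c <= m)%N -> (k * m + c <= n)%N -> (c <= #|clique_block m n k|)%N.
Proof.
move=> cm kn.
have lt (j : 'I_c) : (k * m + j < n)%N by apply: leq_trans kn; rewrite ltn_add2l.
rewrite -[leqLHS]card_ord -cardsT.
rewrite -(@card_imset _ _ (fun j : 'I_c => Ordinal (lt j))); last first.
  by move=> i j [] /addnI/val_inj.
apply/subset_leq_card/subsetP => _ /imsetP[j _ ->]; rewrite inE /=.
have jm : (j < m)%N by apply: leq_trans cm.
by rewrite divnMDl ?(leq_ltn_trans _ jm) // divn_small // addn0.
Qed.

(** For [n = a * m + b] with [b < m], block number [a] holds the [b] leftover vertices. *)
Definition disjoint_cliques (r m n a : nat) : {set {set 'I_n}} :=
  \bigcup_(k < a.+1) [set e : {set 'I_n} | e \subset clique_block m n k & #|e| == r].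

Lemma disjoint_cliques_uniform (r m n a : nat) : uniform r (disjoint_cliques r m n a).
Proof. by apply/forall_inP => e /bigcupP[k _]; rewrite inE => /andP[]. Qed.

Lemma card_disjoint_cliques (r m a b : nat) : (0 < r)%N -> (b <= m)%N ->
  (a * 'C(m, r) + 'C(b, r) <= #|disjoint_cliques r m (a * m + b) a|)%N.
Proof.
move=> r0 bm; rewrite -sum1_card /disjoint_cliques partition_disjoint_bigcup /=; last first.
  move=> k l kl; apply/pred0P => e /=; rewrite !inE.
  apply/negP => /andP[/andP[ek er] /andP[el _]].
  (* Edges are nonempty, so none lies in two blocks. *)
  have /card_gt0P[x xe] : (0 < #|e|)%N by rewrite (eqP er).
  move: (subsetP ek x xe) (subsetP el x xe); rewrite !inE => /eqP-> /eqP/val_inj/eqP.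
  exact/negP.
rewrite big_ord_recr /= sum1_card cards_draws leq_add ?leq_bin2l //; last first.
  exact: card_clique_block_ge.
rewrite -[X in (X * _)%N]card_ord -sum_nat_const; apply: leq_sum => k _.
rewrite sum1_card cards_draws leq_bin2l // card_clique_block_ge //.
by rewrite -mulSnr (leq_trans _ (leq_addr _ _)) // leq_mul2r ltn_ord orbT.
Qed.

Lemma disjoint_cliques_star_free (r s m n a : nat) : (0 < m < r + s)%N ->
  ~~ induced_Berge (star s.+1) (disjoint_cliques r m n a).
Proof.
case/andP=> m0 mrs; apply/negP => /star_inducedP[c [w [f P]]].
(* All edges of the star contain [c], hence lie in the block of [c]. *)
have fc i : f i \subset clique_block m n (c %/ m).
  have [/bigcupP[k _]] := P i; rewrite inE => /andP[fk _] cf _ _.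
  by move: (subsetP fk c cf); rewrite inE => /eqP->.
have winj : injective w.
  by move=> i j wij; have [_ _ _ fj] := P j; apply/eqP; rewrite -fj wij fj.
have [fH _ _ f0] := P ord0.
have fr : #|f ord0| = r.
  exact/eqP/(forall_inP (disjoint_cliques_uniform r m n a)).
(* The [s] leaves other than that of [f ord0]: they avoid [f ord0] but stay in the block, which then
   has at least [r + s] vertices. *)
pose W := w @: [set~ ord0].
have cW : #|W| = s by rewrite card_imset // cardsC1 card_ord.
have dW : [disjoint f ord0 & W].
  rewrite disjoint_sym; apply/pred0P => x /=; apply/negP => /andP[/imsetP[j]].
  by rewrite !inE => j0 ->; rewrite f0 (negPf j0).
have sub : f ord0 :|: W \subset clique_block m n (c %/ m).
  rewrite subUset fc; apply/subsetP => _ /imsetP[j _ ->].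
  by have [_ _ _ fj] := P j; rewrite (subsetP (fc j)) // fj.
have := leq_trans (subset_leq_card sub) (card_clique_block_le m n (c %/ m) m0).
have /eqP -> : #|f ord0 :|: W| == (#|f ord0| + #|W|)%N by rewrite (leq_card_setU _ _).2.
by rewrite fr cW leqNgt mrs.
Qed.

(** * Assembly of the bounds, with [s = t - 2] *)

Theorem theorem2p4 (r t n a b : nat)
    (hr : (2 <= r)%N) (ht : (3 <= t)%N)
    (hn : n = (a * (r + t - 3) + b)%N) (hb : (b <= r + t - 4)%N) :
  [/\ (a * 'C(r + t - 3, r) + 'C(b, r) <= ex_ind_Berge r n (star (t - 1)))%N,
      (ex_ind_Berge r n (star (t - 1)))%:R
        <= n%:R / r%:R * 'C(r + t - 3, r - 1)%:R :> rat
    & (r + t - 3 %| n)%N ->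
      (a * 'C(r + t - 3, r) + 'C(b, r))%:R
        = n%:R / r%:R * 'C(r + t - 4, r - 1)%:R :> rat].
Proof.
have r0 : (0 < r)%N by lia.
have -> : (t - 1 = (t - 2).+1)%N by lia.
split.
- apply: leq_trans (card_disjoint_cliques r (r + t - 3) a b r0 _) _; first lia.
  rewrite -hn; apply: leq_bigmax_cond; rewrite disjoint_cliques_uniform.
  by apply: disjoint_cliques_star_free; lia.
(* Passing to the integer quotient by [r] isolates the maximum, so each [H] can be bounded
   separately. *)
- rewrite mulrAC ler_pdivlMr ?ltr0n // -!natrM ler_nat -leq_divRL //.
  apply/bigmax_leqP => H /andP[unif free]; rewrite leq_divRL //.
  have := star_free_card r (t - 2) _ H unif free; rewrite card_ord.
  have -> : (r.-1 + (t - 2) = r + t - 3)%N by lia.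
  by rewrite -subn1.
- rewrite hn dvdn_addr ?dvdn_mull // => dvdb.
  have b0 : b = 0%N by apply: contraTeq dvdb => b0; rewrite gtnNdvd //; lia.
  rewrite b0 bin0n eqn0Ngt r0 !addn0 mulrAC.
  apply: (canRL (mulfK _)); first by rewrite pnatr_eq0 -lt0n.
  rewrite -!natrM; congr (_%:R).
  (* With [m = r + t - 3], the identity is [m * 'C(m - 1, r - 1) = r * 'C(m, r)]. *)
  have := mul_bin_diag (r + t - 3) r.-1; rewrite prednK //.
  have -> : ((r + t - 3).-1 = r + t - 4)%N by lia.
  by rewrite -subn1 -!mulnA => ->; rewrite [(_ * r)%N]mulnC.
Qed.
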